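(* Let $0\le\gamma<1$, $\alpha=\frac{4}{3+\gamma}$, let $\Omega\subset\mathbb{R}^n$ be a bounded smooth domain, $\varphi\ge0$ a smooth boundary datum, $\varepsilon>0$, and let $u_\varepsilon$ be the minimal solution of $$\Delta_\infty u=\mathcal{B}_\varepsilon(u)\,u^{-\gamma}\ \text{ in }\Omega,\qquad u=\varphi\ \text{ on }\partial\Omega .$$ There exists $c>0$, depending only on $\gamma$, such that for each $x\in\Omega$ with $u_\varepsilon(x)\ge c\,\varepsilon^\alpha$ one has $$\sup_{B_r(x)}u_\varepsilon\ge c\,r^\alpha\qquad\text{for }\varepsilon\le r\le\tfrac12\,\mathrm{dist}(x,\partial\Omega).$$
   Context: $\Delta_\infty u=\sum_{i,j}D_{ij}u\,D_iu\,D_ju$, understood in the viscosity sense. Fix $\delta=\frac12\alpha^{-4/(3+\gamma)}$ and a Lipschitz function $\mathcal{B}:\mathbb{R}\to\mathbb{R}$ with $0\le\mathcal{B}\le1$, $\mathcal{B}(s)=0$ for $s\le\delta/2$ and $\mathcal{B}(s)=1$ for $s\ge\delta$. For $\varepsilon>0$ put $\mathcal{B}_\varepsilon(s)=\mathcal{B}(s/\varepsilon^\alpha)$; the expression $\mathcal{B}_\varepsilon(s)s^{-\gamma}$ is taken to be $0$ for $s\le\frac{\delta}{2}\varepsilon^\alpha$. Let $\underline u,\overline u\in C(\overline\Omega)$ be the viscosity solutions of $\Delta_\infty\underline u=(\delta/2)^{-\gamma}\varepsilon^{-\alpha\gamma}$ and $\Delta_\infty\overline u=0$ in $\Omega$ with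 $\underline u=\overline u=\varphi$ on $\partial\Omega$. The minimal (Perron) solution is $$u_\varepsilon(x)=\inf\{w(x): w\in C(\overline\Omega)\text{ is a viscosity supersolution of the problem},\ \underline u\le w\le\overline u\text{ in }\overline\Omega\},$$ where a viscosity supersolution satisfies $\Delta_\infty w\le\mathcal{B}_\varepsilon(w)w^{-\gamma}$ in the viscosity sense; $u_\varepsilon$ is a nonnegative continuous viscosity solution of the problem. *)

(* Defs.v *)
From HB Require Import structures.
From mathcomp Require Import all_boot all_order all_algebra.
From mathcomp Require Import all_classical all_reals all_analysis.
Import Order.TTheory GRing.Theory Num.Theory.
Import numFieldNormedType.Exports.

Set Implicit Arguments.
Unset Strict Implicit.
Unset Printing Implicit Defensive.

Local Open Scope classical_set_scope.
Local Open Scope ring_scope.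

(* R^N with N = n.+1 >= 1 is 'rV[R]_n.+1. Its library norm is the sup norm; it
   induces the usual topology, but balls and distances below are Euclidean. *)
Section euclidean.
Context {R : realType} {n : nat}.
Local Notation V := 'rV[R]_n.+1.

Definition enorm (x : V) : R := Num.sqrt (\sum_(i < n.+1) x 0 i ^+ 2).

Definition eball (x : V) (r : R) : set V := [set y | enorm (y - x) < r].

Definition bdry (A : set V) : set V := closure A `\` interior A.

Definition edist_to (A : set V) (x : V) : R :=
  inf [set enorm (x - y) | y in A].

Definition pderiv (i : 'I_n.+1) (f : V -> R) : V -> R :=
  'D_(delta_mx 0 i : V) f.

(* f is of class C^k on U; meaningful for open U. *)
Fixpoint Ck (k : nat) (U : set V) (f : V -> R) : Prop :=
  match k with
  | 0 => {in U, continuous f}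
  | k'.+1 => {in U, continuous f} /\
      forall i : 'I_n.+1,
        {in U, forall x, derivable f x (delta_mx 0 i : V)} /\
        Ck k' U (pderiv i f)
  end.

Definition smooth_on (U : set V) (f : V -> R) : Prop := forall k, Ck k U f.

(* Near each boundary point Omega is the sublevel set of a smooth function
   with nonvanishing gradient there. *)
Definition smooth_boundary (Omega : set V) : Prop :=
  forall x, bdry Omega x ->
    exists (U : set V) (rho : V -> R),
      [/\ open U, U x, smooth_on U rho,
          exists i, pderiv i rho x != 0
        & Omega `&` U = [set y | rho y < 0] `&` U].

Definition bounded_smooth_domain (Omega : set V) : Prop :=
  [/\ open Omega, connected Omega, Omega !=set0, bounded_set Omega
    & smooth_boundary Omega].

(* A smooth function on bdry Omega is the restriction of one on R^N. *)
Definition smooth_boundary_datum (Omega : set V) (phi : V -> R) : Prop :=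
  exists2 g : V -> R, smooth_on setT g & {in bdry Omega, g =1 phi}.

Definition inf_laplacian (u : V -> R) (x : V) : R :=
  \sum_(i < n.+1) \sum_(j < n.+1)
    pderiv i (pderiv j u) x * pderiv i u x * pderiv j u x.

(* Viscosity notions for Delta_oo u = f(u) in Omega. *)
Definition visc_supersolution (Omega : set V) (f : R -> R) (w : V -> R) :=
  forall (psi : V -> R) (x : V), Omega x -> Ck 2 Omega psi ->
    (\forall y \near x, w x - psi x <= w y - psi y) ->
    inf_laplacian psi x <= f (w x).

Definition visc_subsolution (Omega : set V) (f : R -> R) (w : V -> R) :=
  forall (psi : V -> R) (x : V), Omega x -> Ck 2 Omega psi ->
    (\forall y \near x, w y - psi y <= w x - psi x) ->
    f (w x) <= inf_laplacian psi x.

Definition visc_dirichlet_solution (Omega : set V) (f : R -> R)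
    (phi u : V -> R) : Prop :=
  [/\ {within closure Omega, continuous u},
      visc_subsolution Omega f u, visc_supersolution Omega f u
    & {in bdry Omega, u =1 phi}].

End euclidean.

Section singular_problem.
Context {R : realType}.

Definition alpha (gamma : R) : R := 4 / (3 + gamma).

Definition delta (gamma : R) : R :=
  2^-1 * alpha gamma `^ (- (4 / (3 + gamma))).

Definition admissible_cutoff (gamma : R) (B : R -> R) : Prop :=
  [/\ lipschitz B,
      forall s, 0 <= B s <= 1,
      forall s, s <= delta gamma / 2 -> B s = 0
    & forall s, delta gamma <= s -> B s = 1].

Definition rhs (gamma : R) (B : R -> R) (eps s : R) : R :=
  if s <= delta gamma / 2 * eps `^ alpha gamma then 0
  else B (s / eps `^ alpha gamma) * s `^ (- gamma).

Definition lower_rhs (gamma eps : R) : R :=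
  (delta gamma / 2) `^ (- gamma) * eps `^ (- (alpha gamma * gamma)).

Context {n : nat}.
Local Notation V := 'rV[R]_n.+1.

(* The condition w = phi on the boundary follows from ulow <= w <= uup, as both
   barriers equal phi there. *)
Definition perron_class (gamma : R) (B : R -> R) (eps : R) (Omega : set V)
    (ulow uup : V -> R) : set (V -> R) :=
  [set w | [/\ {within closure Omega, continuous w},
      visc_supersolution Omega (rhs gamma B eps) w
    & forall x, closure Omega x -> ulow x <= w x <= uup x]].

Definition minimal_solution (gamma : R) (B : R -> R) (eps : R) (Omega : set V)
    (ulow uup : V -> R) (x : V) : R :=
  inf [set w x | w in perron_class gamma B eps Omega ulow uup].

End singular_problem.

(* Main.v *)
(* Let delta be the constant of the cutoff, c = (1/2)^(alpha/2) and
   k = (delta eps^alpha)^(2/alpha).  The smooth radial function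
     g(y) = (k + |y - x|^2 / 2)^(alpha/2)
   satisfies Delta_oo g < g^(-gamma), is at least delta eps^alpha, so that the
   cutoff equals 1 along g and g is a strict supersolution, takes the value
   delta eps^alpha < c eps^alpha at x, and exceeds c s^alpha on |y - x| = s.
   If sup_{B_r(x)} u < c r^alpha, then for some s < r one has u < g on the
   sphere |y - x| = s; as the Perron class is stable under minimum, compactness
   yields one w in the class with w < g on that sphere.  Replacing w by
   min(w, g) in B_s(x) gives another member of the class, the lower barrier
   staying below g by comparison.  Hence u(x) <= g(x) < c eps^alpha. *)
Require Import Defs.
From mathcomp Require Import all_boot all_order all_algebra.
From mathcomp Require Import all_classical all_reals all_analysis.
From mathcomp Require Import ring lra.
Import Order.TTheory GRing.Theory Num.Theory.
Import numFieldNormedType.Exports.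
Local Open Scope classical_set_scope.
Local Open Scope ring_scope.

Set Implicit Arguments.
Unset Strict Implicit.
Unset Printing Implicit Defensive.

(** * Directional derivatives and the one-variable second derivative test *)

Lemma cvg_is_derive {R : realType} {V : normedModType R} (f : V -> R)
    (a v : V) (l : R) :
  h^-1 *: (f (h *: v + a) - f a) @[h --> (0:R)^'] --> l ->
  is_derive a v f l.
Proof.
move=> fl; apply: DeriveDef; first exact: cvgP fl.
exact: cvg_lim fl.
Qed.

(** Both difference quotients are the same function of [h]; this hands the calculus on lines over to
    one-variable theorems. *)
Lemma is_derive_lineP {R : realType} {V : normedModType R} (f : V -> R)
    (a v : V) (t df : R) :
  is_derive (a + t *: v) v f df <->
  is_derive t (1:R) (fun s : R => f (a + s *: v)) df.
Proof.
have E : (fun h : R => h^-1 *: (f (a + (h *: 1 + t) *: v) - f (a + t *: v)))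
  = (fun h => h^-1 *: (f (h *: v + (a + t *: v)) - f (a + t *: v))).
  apply/funext => h; congr (_ *: (f _ - _)).
  by rewrite scalerDl addrCA [h *: 1]mulr1.
split=> -[fd <-]; apply: cvg_is_derive.
  rewrite E; exact: fd.
rewrite -E; exact: fd.
Qed.

(** The sign of [t] is left free because the coordinate steps in [is_derive_C1] have signed
    lengths. *)
Lemma MVT_line {R : realType} {V : normedModType R} (f : V -> R) (a v : V)
    (t : R) :
  (forall s : R, `|s| <= `|t| -> derivable f (a + s *: v) v) ->
  exists2 s : R, `|s| <= `|t| & f (a + t *: v) - f a = t * 'D_v f (a + s *: v).
Proof.
move=> fd.
have gd (s : R) : `|s| <= `|t| ->
    is_derive s 1 (fun s => f (a + s *: v)) ('D_v f (a + s *: v)).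
  move=> st; apply/(is_derive_lineP f a v); exact: (derivableP (fd s st)).
have gc (A : set R) : A `<=` [set s | `|s| <= `|t|] ->
    {within A, continuous (fun s => f (a + s *: v))}.
  move=> At; apply/subspace_continuousP => s /At/gd[sd _].
  apply: cvg_within_filter.
  by apply/differentiable_continuous/derivable1_diffP.
have a0 : a = a + 0 *: v by rewrite scale0r addr0.
have [t0|t0] := leP 0 t.
- have tI (s : R) : 0 <= s <= t -> `|s| <= `|t|.
    by case/andP=> s0 st; rewrite !ger0_norm.
  have [s||s /[!in_itv]/= sI e] := @MVT_segment _ (fun s => f (a + s *: v))
     (fun s => 'D_v f (a + s *: v)) 0 t t0.
  + by rewrite in_itv/= => /andP[/ltW s0 /ltW st]; apply/gd/tI; rewrite s0.
  + by apply: gc => s /=; rewrite in_itv/= => /tI.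
  + exists s; first exact: tI.
    by rewrite {2}a0 e subr0 mulrC.
- have tI (s : R) : t <= s <= 0 -> `|s| <= `|t|.
    by case/andP=> s0 st; rewrite !ler0_norm ?lerN2 // ltW.
  have [s||s /[!in_itv]/= sI e] := @MVT_segment _ (fun s => f (a + s *: v))
     (fun s => 'D_v f (a + s *: v)) t 0 (ltW t0).
  + by rewrite in_itv/= => /andP[/ltW s0 /ltW st]; apply/gd/tI; rewrite s0.
  + by apply: gc => s /=; rewrite in_itv/= => /tI.
  + exists s; first exact: tI.
    by rewrite {2}a0 -opprB e sub0r mulrN opprK mulrC.
Qed.

(** [Ck] only controls coordinate directions, while the second derivative test runs along arbitrary
    lines. The increment is split into coordinate steps, and continuity of the partial derivatives
    at [a] moves the intermediate points back to [a]. *)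
Lemma is_derive_C1 {R : realType} {n : nat} (f : 'rV[R]_n.+1 -> R)
    (a p : 'rV[R]_n.+1) :
  (\forall y \near a, forall i, derivable f y (delta_mx 0 i : 'rV[R]_n.+1)) ->
  (forall i, {for a, continuous (pderiv i f)}) ->
  is_derive a p f (\sum_(i < n.+1) p 0 i * pderiv i f a).
Proof.
move=> fd fc; apply: cvg_is_derive.
apply/cvgrPdist_le => /= e e0.
(* The summand 1 keeps [C] positive when [p] vanishes. *)
pose C := 1 + \sum_(i < n.+1) `|p 0 i|.
have C0 : 0 < C by rewrite ltr_pwDl// sumr_ge0.
have eC0 : 0 < e / C by rewrite divr_gt0.
have near_a : \forall y \near a, forall i,
    derivable f y (delta_mx 0 i : 'rV[R]_n.+1) /\
    `|pderiv i f a - pderiv i f y| <= e / C.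
  have : \forall y \near a, forall i, `|pderiv i f a - pderiv i f y| <= e / C.
    by apply: (filter_forall (F := nbhs a)) => i; move/cvgrPdist_le: (fc i) => /(_ _ eC0).
  by apply: filterS2 fd => y ? ? i; split.
have [d /= d0 dP] := (nbhs_ballP _ _).1 near_a.
have {}dP y : `|y| < d -> forall i,
    derivable f (a + y) (delta_mx 0 i : 'rV[R]_n.+1) /\
    `|pderiv i f a - pderiv i f (a + y)| <= e / C.
  move=> yd; apply: dP; rewrite -ball_normE /ball_/=.
  by rewrite opprD addNKr normrN.
have hp0 : \forall h \near (0:R), `|h *: p| < d.
  have : h *: p @[h --> (0:R)] --> (0 : 'rV[R]_n.+1).
    by rewrite -[X in _ --> X](scale0r p); apply: cvgZr_tmp => //; exact: cvg_id.
  by move/cvgrPdist_lt/(_ _ d0); apply: filterS => h; rewrite sub0r normrN.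
have : \forall h \near (0:R)^', h != 0 /\ `|h *: p| < d.
  apply: filterS2 (nbhs_dnbhs_neq 0) (nbhs_dnbhs hp0) => h h0 hd.
  by split.
apply: filterS => h [h0 hd].
(* Path from a to a + h p along the coordinate axes, one MVT on each leg. *)
pose hk (k : nat) : 'rV[R]_n.+1 := \row_j (if (j < k)%N then h * p 0 j else 0).
pose e_ (i : 'I_n.+1) : 'rV[R]_n.+1 := delta_mx 0 i.
have hkS (i : 'I_n.+1) : hk i.+1 = hk i + (h * p 0 i) *: e_ i.
  apply/rowP => j; rewrite !mxE eqxx/= ltnS.
  have [ji|ji|/val_inj ->] := ltngtP j i.
  - by rewrite (_ : (j == i) = false) ?mulr0 ?addr0//; apply: ltn_eqF.
  - by rewrite (_ : (j == i) = false) ?mulr0 ?addr0//; apply: gtn_eqF.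
  - by rewrite eqxx mulr1 add0r.
(* The norm is the sup norm, and each coordinate of an intermediate point is bounded by the same
   coordinate of [h *: p]. *)
have small (i : 'I_n.+1) (s : R) : `|s| <= `|h * p 0 i| ->
    `|hk i + s *: e_ i| < d.
  move=> si; apply: le_lt_trans hd.
  rewrite [leLHS]mx_normrE; apply/bigmax_leP; split=> //= -[i0 j] _ /=.
  rewrite ord1 !mxE eqxx /=.
  apply: (@le_trans _ _ `|(h *: p) 0 j|); last first.
    rewrite [leRHS]mx_normrE.
    by apply: (le_bigmax_cond _ (fun ij => `|(h *: p) ij.1 ij.2| : R) (j := (0, j))).
  rewrite mxE; have [->|ji] := eqVneq j i; first by rewrite ltnn mulr1 add0r.
  by rewrite mulr0 addr0; case: ifP => // _; rewrite normr0.
have mvt (i : 'I_n.+1) : exists y : 'rV[R]_n.+1, `|y| < d /\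
    f (a + hk i.+1) - f (a + hk i) = h * p 0 i * pderiv i f (a + y).
  have [s si fs] : exists2 s : R, `|s| <= `|h * p 0 i| &
      f (a + hk i + (h * p 0 i) *: e_ i) - f (a + hk i) =
        h * p 0 i * 'D_(e_ i) f (a + hk i + s *: e_ i).
    apply: MVT_line => s si; rewrite -addrA.
    by have [] := dP _ (small i s si) i.
  exists (hk i + s *: e_ i); split; first exact: small.
  by rewrite hkS addrA fs /pderiv addrA.
have [y yP] := choice mvt.
have -> : f (h *: p + a) - f a = \sum_(i < n.+1) h * p 0 i * pderiv i f (a + y i).
  under eq_bigr => i _ do rewrite -(yP i).2.
  rewrite -(big_mkord xpredT (fun i => f (a + hk i.+1) - f (a + hk i))).
  rewrite telescope_sumr//.
  have -> : hk n.+1 = h *: p by apply/rowP => j; rewrite !mxE ltn_ord.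
  have -> : hk 0%N = 0 by apply/rowP => j; rewrite !mxE.
  by rewrite addr0 [h *: p + a]addrC.
rewrite scaler_sumr -sumrB.
apply: (le_trans (ler_norm_sum _ _ _)).
apply: (@le_trans _ _ (\sum_(i < n.+1) `|p 0 i| * (e / C))).
  apply: ler_sum => i _.
  have -> : p 0 i * pderiv i f a - h^-1 *: (h * p 0 i * pderiv i f (a + y i))
    = p 0 i * (pderiv i f a - pderiv i f (a + y i)).
    by rewrite /GRing.scale/= mulrBr -!mulrA mulKf.
  by rewrite normrM ler_wpM2l//; have [] := dP _ (yP i).1 i.
rewrite -mulr_suml mulrCA ger_pMr// ler_pdivrMr// mul1r /C.
by rewrite lerDr.
Qed.

(** If [g2] were negative, [g1], which vanishes at 0, would be negative just to the right of 0, and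
    the mean value theorem would give [g h < g 0] for a small [h > 0]. *)
Lemma derive2_at_local_min {R : realType} (g g1 : R -> R) (g2 : R) :
  (\forall t \near (0:R), is_derive t (1:R) g (g1 t)) ->
  is_derive (0:R) 1 g1 g2 ->
  (\forall t \near (0:R), g 0 <= g t) ->
  g1 0 = 0 /\ 0 <= g2.
Proof.
move=> gd [g1d g1v] gmin.
have [e /= e0 eP] := (nbhs_ballP _ _).1 (filterI gd gmin).
have {}eP (t : R) : `|t| < e -> is_derive t (1:R) g (g1 t) /\ g 0 <= g t.
  by move=> te; apply: eP; rewrite -ball_normE /ball_/= sub0r normrN.
have g10 : g1 0 = 0.
  have itvP t : t \in `](- e), e[%R -> `|t| < e by rewrite in_itv/= ltr_norml.
  have [||||_ g0] := @derive1_at_min _ g (- e) e 0.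
  - by rewrite (le_trans _ (ltW e0))// oppr_le0 ltW.
  - by move=> t /itvP/eP[[]].
  - by rewrite in_itv/= oppr_lt0 e0.
  - by move=> t /itvP/eP[].
  - by have [|[_ <-] _] := eP 0; rewrite ?normr0.
split=> //; rewrite leNgt; apply/negP => g20.
have : \forall h \near (0:R)^', h^-1 * g1 h < 0.
  have : h^-1 *: (g1 (h *: 1 + 0) - g1 0) @[h --> (0:R)^'] --> g2.
    by rewrite -g1v; exact: g1d.
  move/cvgr_lt/(_ _ g20); apply: filterS => h.
  by rewrite g10 subr0 addr0 [h *: 1]mulr1.
rewrite near_withinE => /nbhs_ballP[d /= d0 dP].
have g1N t : 0 < t < d -> g1 t < 0.
  move=> /andP[t0 td]; have := dP t.
  rewrite -ball_normE /ball_/= sub0r normrN gtr0_norm// => /(_ td (lt0r_neq0 t0)).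
  by rewrite pmulr_rlt0// invr_gt0.
pose h := Num.min e d / 2.
have m0 : 0 < Num.min e d by rewrite lt_min e0.
have h0 : 0 < h by rewrite divr_gt0.
have hm : h < Num.min e d by rewrite ltr_pdivrMr// ltr_pMr// ltr1n.
have /andP[he hd] : (h < e) && (h < d) by rewrite -lt_min.
have dg (t : R) : 0 <= t <= h -> is_derive t (1:R) g (g1 t).
  move=> /andP[t0 th]; apply: (eP t _).1.
  by rewrite ger0_norm// (le_lt_trans th).
have [t||t /[!in_itv]/= /andP[t0 th] gE] := @MVT _ g g1 0 h h0.
- by rewrite in_itv/= => /andP[/ltW t0 /ltW th]; apply: dg; rewrite t0.
- apply/subspace_continuousP => t /= /[!in_itv]/= /dg[td _].
  apply: cvg_within_filter.
  by apply/differentiable_continuous/derivable1_diffP.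
have : g 0 <= g h by apply: (eP h _).2; rewrite gtr0_norm.
rewrite -subr_ge0 gE subr0 pmulr_lge0// leNgt g1N// t0/=.
exact: lt_trans hd.
Qed.

(** * Functions of class C^2 touching at a point *)

Section Ck2.
Context {R : realType} {n : nat}.
Local Notation V := 'rV[R]_n.+1.

Lemma Ck1_is_derive (Omega : set V) (f : V -> R) (y p : V) :
  open Omega -> Omega y -> Ck 1 Omega f ->
  is_derive y p f (\sum_(i < n.+1) p 0 i * pderiv i f y).
Proof.
move=> oO Oy [_ fC]; apply: is_derive_C1.
  near=> z => i; apply: (fC i).1; rewrite inE.
  by near: z; exact: open_nbhs_nbhs.
by move=> i; apply: (fC i).2; rewrite inE.
Unshelve. all: by end_near. Qed.

Lemma Ck2_is_derive_line (Omega : set V) (f : V -> R) (z p : V) :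
  open Omega -> Omega z -> Ck 2 Omega f ->
  (\forall t \near (0:R), is_derive t (1:R) (fun t : R => f (z + t *: p))
      (\sum_(i < n.+1) p 0 i * pderiv i f (z + t *: p))) /\
  is_derive (0:R) 1 (fun t : R => \sum_(i < n.+1) p 0 i * pderiv i f (z + t *: p))
    (\sum_(i < n.+1) p 0 i * \sum_(j < n.+1) p 0 j * pderiv j (pderiv i f) z).
Proof.
move=> oO Oz [f0 fC].
have C1f : Ck 1 Omega f.
  by split=> // i; split; [exact: (fC i).1|exact: (fC i).2.1].
split.
  have : \forall t \near (0:R), Omega (z + t *: p).
    have : z + t *: p @[t --> (0:R)] --> z + 0 *: p.
      by apply: cvgD; [exact: cvg_cst|apply: cvgZr_tmp; exact: cvg_id].
    by apply; rewrite scale0r addr0; exact: open_nbhs_nbhs.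
  apply: filterS => t Ot; apply/(is_derive_lineP f z p t).
  exact: (Ck1_is_derive _ oO Ot C1f).
have -> : (fun t => \sum_(i < n.+1) p 0 i * pderiv i f (z + t *: p)) =
    \sum_(i < n.+1) (p 0 i *: (fun t : R => pderiv i f (z + t *: p))).
  by apply/funext => t; rewrite fct_sumE.
apply: is_derive_sum => i; apply: is_deriveZ.
apply/(is_derive_lineP (pderiv i f) z p 0); rewrite scale0r addr0.
exact: (Ck1_is_derive _ oO Oz (fC i).2).
Qed.

(** At a local minimum of [g - f] the gradients agree and the Hessian of [g - f] is nonnegative as a
    quadratic form, by the one-variable test on every line through [z]. The infinity Laplacian is
    the Hessian form evaluated at the common gradient. *)
Lemma inf_laplacian_touch (Omega : set V) (f g : V -> R) (z : V) :
  open Omega -> Omega z -> Ck 2 Omega f -> Ck 2 Omega g ->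
  (\forall y \near z, g z - f z <= g y - f y) ->
  inf_laplacian f z <= inf_laplacian g z.
Proof.
move=> oO Oz fC gC fg.
have test (p : V) : (\sum_(i < n.+1) p 0 i * pderiv i g z
     = \sum_(i < n.+1) p 0 i * pderiv i f z) /\
    \sum_(i < n.+1) p 0 i * \sum_(j < n.+1) p 0 j * pderiv j (pderiv i f) z <=
    \sum_(i < n.+1) p 0 i * \sum_(j < n.+1) p 0 j * pderiv j (pderiv i g) z.
  have [f1 f2] := Ck2_is_derive_line p oO Oz fC.
  have [g1 g2] := Ck2_is_derive_line p oO Oz gC.
  have [||] := derive2_at_local_min (g := (fun t => g (z + t *: p)) -
    (fun t => f (z + t *: p))) _ (is_deriveB g2 f2).
  - apply: filterS2 f1 g1 => t f1 g1; exact: is_deriveB.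
  - have : z + t *: p @[t --> (0:R)] --> z + 0 *: p.
      by apply: cvgD; [exact: cvg_cst|apply: cvgZr_tmp; exact: cvg_id].
    rewrite scale0r addr0 => /(_ _ fg) => fgt.
    have : \forall t \near (0:R), g z - f z <= g (z + t *: p) - f (z + t *: p).
      exact: fgt.
    by apply: filterS => t; rewrite !fctE scale0r addr0.
  - by rewrite !fctE scale0r addr0 subr_ge0 => /subr0_eq.
have grad i : pderiv i g z = pderiv i f z.
  have [+ _] := test (delta_mx 0 i).
  rewrite (bigD1 i)// big1/=; last first.
    by move=> j /negPf ji; rewrite mxE ji andbF mul0r.
  rewrite (bigD1 i)// big1/=; last first.
    by move=> j /negPf ji; rewrite mxE ji andbF mul0r.
  by rewrite mxE !eqxx !mul1r !addr0.
(* Exchanging the two sums puts the derivatives in the order they have in [test], whose direction is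
   then taken to be the gradient. *)
have lapE u : (forall i, pderiv i u z = pderiv i f z) -> inf_laplacian u z =
    \sum_(i < n.+1) (\row_k pderiv k f z) 0 i * \sum_(j < n.+1)
      (\row_k pderiv k f z) 0 j * pderiv j (pderiv i u) z.
  move=> uf; rewrite /inf_laplacian exchange_big; apply: eq_bigr => i _.
  rewrite mulr_sumr; apply: eq_bigr => j _; rewrite !mxE !uf.
  by rewrite mulrA [RHS]mulrC mulrA mulrAC.
have [_ h] := test (\row_k pderiv k f z).
by rewrite (lapE f (fun=> erefl)) (lapE g grad).
Qed.

End Ck2.

(** Restriction to a line reduces this to the one-variable chain rule. *)
Lemma is_derive_comp1 {R : realType} {V : normedModType R} (f : V -> R)
    (g : R -> R) (y v : V) (df dg : R) :
  is_derive (f y) 1 g dg -> is_derive y v f df ->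
  is_derive y v (g \o f) (dg * df).
Proof.
have y0 : y = y + 0 *: v by rewrite scale0r addr0.
move=> gd fd; rewrite y0; apply/(is_derive_lineP (g \o f) y v 0).
have {}fd : is_derive (0:R) (1:R) (fun s : R => f (y + s *: v)) df.
  by apply/(is_derive_lineP f y v 0); rewrite -y0.
have {}gd : is_derive (f (y + 0 *: v)) 1 g dg by rewrite -y0.
have := @is_derive1_comp R g (fun s : R => f (y + s *: v)) 0 dg df gd fd.
exact.
Qed.

(** * The radial barrier and its infinity Laplacian *)

Section barrier.
Context {R : realType} {n : nat}.
Local Notation V := 'rV[R]_n.+1.

Definition sqdist (x y : V) : R := \sum_(i < n.+1) (y 0 i - x 0 i) ^+ 2.

(** The exponent is a parameter because the derivatives are expressed by the same family with
    exponents [b - 1] and [b - 2]. A positive [k] keeps the base positive, hence the power smooth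
    even at [x]. *)
Definition barrier (k b : R) (x y : V) : R := (k + 2^-1 * sqdist x y) `^ b.

Lemma is_derive_coord (i : 'I_n.+1) (y v : V) :
  is_derive y v (fun y : V => y 0 i) (v 0 i).
Proof.
apply: cvg_is_derive.
apply: (@cvg_trans _ (v 0 i @[h --> (0:R)^'])); last exact: cvg_cst.
apply: near_eq_cvg; near=> h.
rewrite mxE mxE addrK scalerA mulVf ?scale1r//.
by near: h; exact: nbhs_dnbhs_neq.
Unshelve. all: by end_near. Qed.

Lemma is_derive_sqdist (x y v : V) :
  is_derive y v (sqdist x) (2 * \sum_(i < n.+1) (y 0 i - x 0 i) * v 0 i).
Proof.
have -> : sqdist x = \sum_(i < n.+1) ((fun y : V => y 0 i) - cst (x 0 i)) ^+ 2.
  by apply/funext => z; rewrite fct_sumE.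
rewrite mulr_sumr; apply: is_derive_sum => i.
have h := is_deriveX 2 (is_deriveB (is_derive_coord i y v)
  (is_derive_cst (x 0 i) y v)).
apply: is_derive_eq h _; rewrite subr0 expr1 [RHS]mulrA; congr (_ * _).
Qed.

Lemma sqdist_ge0 (x y : V) : 0 <= sqdist x y.
Proof. by apply: sumr_ge0 => i _; exact: sqr_ge0. Qed.

Lemma barrier_arg_gt0 (k : R) (x y : V) : 0 < k -> 0 < k + 2^-1 * sqdist x y.
Proof. by move=> k0; rewrite ltr_pwDl// mulr_ge0// sqdist_ge0. Qed.

Lemma is_derive_barrier (k b : R) (x y v : V) : 0 < k ->
  is_derive y v (barrier k b x)
    (b * barrier k (b - 1) x y * \sum_(i < n.+1) (y 0 i - x 0 i) * v 0 i).
Proof.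
move=> k0.
have := is_deriveD (is_derive_cst k y v)
  (is_deriveZ (2^-1) (is_derive_sqdist x y v)).
rewrite add0r /GRing.scale/= mulrA mulVf ?mul1r// => h.
have pd := is_derive1_powR b (barrier_arg_gt0 x y k0).
exact: (is_derive_comp1 (f := fun y : V => k + 2^-1 * sqdist x y) pd h).
Qed.

Lemma pderiv_barrier (k b : R) (x : V) (i : 'I_n.+1) : 0 < k ->
  pderiv i (barrier k b x) =
  b *: (barrier k (b - 1) x * (fun y : V => y 0 i - x 0 i)).
Proof.
move=> k0; apply/funext => y; rewrite /pderiv.
rewrite (derive_val (is_derive := is_derive_barrier b x y (delta_mx 0 i) k0)).
rewrite (bigD1 i)//= big1/= => [|j /negPf ji]; last by rewrite mxE ji andbF mulr0.
by rewrite mxE !eqxx mulr1 addr0 -mulrA.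
Qed.

Lemma is_derive_pderiv_barrier (k b : R) (x y : V) (i j : 'I_n.+1) : 0 < k ->
  is_derive y (delta_mx 0 i : V) (pderiv j (barrier k b x))
    (b * (b - 1) * barrier k (b - 2) x y * (y 0 i - x 0 i) * (y 0 j - x 0 j)
     + (i == j)%:R * b * barrier k (b - 1) x y).
Proof.
move=> k0; rewrite pderiv_barrier//.
have := is_deriveZ b (is_deriveM
  (is_derive_barrier (b - 1) x y (delta_mx 0 i : V) k0)
  (is_deriveB (is_derive_coord j y (delta_mx 0 i))
    (is_derive_cst (x 0 j) y (delta_mx 0 i)))).
move=> h; apply: is_derive_eq h _.
rewrite (bigD1 i)//= big1/= => [|l /negPf li]; last by rewrite mxE li andbF mulr0.
rewrite !mxE !eqxx/= mulr1 addr0 subr0 !fctE/= /GRing.scale/= eq_sym.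
have -> : b - 1 - 1 = b - 2 by ring.
case: (j == i); ring.
Qed.

Lemma pderiv2_barrier (k b : R) (x : V) (i j : 'I_n.+1) : 0 < k ->
  pderiv i (pderiv j (barrier k b x)) = fun y =>
    b * (b - 1) * barrier k (b - 2) x y * (y 0 i - x 0 i) * (y 0 j - x 0 j)
     + (i == j)%:R * b * barrier k (b - 1) x y.
Proof.
move=> k0; apply/funext => y; rewrite {1}/pderiv.
exact: (derive_val (is_derive := is_derive_pderiv_barrier b x y i j k0)).
Qed.

Lemma continuous_sqdist (x : V) : continuous (sqdist x).
Proof.
move=> y; apply/differentiable_continuous.
have -> : sqdist x = \sum_(i < n.+1) ((fun y : V => y 0 i) - cst (x 0 i)) ^+ 2.
  by apply/funext => z; rewrite fct_sumE.
apply: differentiable_sum => i; apply: differentiableX.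
by apply: differentiableB; [exact: differentiable_coord|exact: differentiable_cst].
Qed.

Lemma continuous_barrier (k b : R) (x : V) : 0 < k ->
  continuous (barrier k b x).
Proof.
move=> k0 y.
apply: (continuous_comp (f := fun z : V => k + 2^-1 * sqdist x z)
  (g := fun z : R => z `^ b)).
  apply: (@cvgD _ _ _ (nbhs y)); first exact: cvg_cst.
  by apply: cvgMl_tmp; exact: continuous_sqdist.
apply/differentiable_continuous/derivable1_diffP.
by have [] := is_derive1_powR b (barrier_arg_gt0 x y k0).
Qed.

Lemma Ck2_barrier (Omega : set V) (k b : R) (x : V) : 0 < k ->
  Ck 2 Omega (barrier k b x).
Proof.
move=> k0; have bc c := @continuous_barrier k c x k0.
have cc (i : 'I_n.+1) : continuous (fun y : V => y 0 i - x 0 i).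
  by move=> y; apply: (@cvgB _ _ _ (nbhs y)); [exact: coord_continuous|exact: cvg_cst].
split; first by move=> y _; exact: bc.
move=> i; split.
  by move=> y _; have [] := is_derive_barrier b x y (delta_mx 0 i) k0.
split.
  rewrite pderiv_barrier// => y _.
  apply: (@cvgMl_tmp _ _ (nbhs y)); apply: (@cvgM _ _ (nbhs y)); [exact: bc|exact: cc].
move=> j; split.
  by move=> y _; have [] := is_derive_pderiv_barrier b x y j i k0.
move=> y _; rewrite pderiv2_barrier//.
apply: (@cvgD _ _ _ (nbhs y)); last by apply: (@cvgMl_tmp _ _ (nbhs y)); exact: bc.
apply: (@cvgM _ _ (nbhs y)); last exact: cc.
apply: (@cvgM _ _ (nbhs y)); last exact: cc.
by apply: (@cvgMl_tmp _ _ (nbhs y)); exact: bc.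
Qed.

(** With d = y - x, the gradient is a multiple of d and the Hessian is a multiple of d d^T plus a
    multiple of the identity. The powers of the base are then collected into the single exponent
    [3 * b - 4]. *)
Lemma inf_laplacian_barrier (k b : R) (x y : V) : 0 < k ->
  inf_laplacian (barrier k b x) y =
  b ^+ 3 * barrier k (3 * b - 4) x y * sqdist x y *
    (k + 2^-1 * sqdist x y + (b - 1) * sqdist x y).
Proof.
move=> k0; have q0 := barrier_arg_gt0 x y k0.
rewrite /inf_laplacian.
have B1 : barrier k (b - 1) x y =
    barrier k (b - 2) x y * (k + 2^-1 * sqdist x y).
  rewrite /barrier -[X in _ = _ * X]powRr1; last exact: ltW.
  rewrite -powRD; last by rewrite (gt_eqF q0) implybT.
  by congr (_ `^ _); ring.
have B3 : barrier k (3 * b - 4) x y =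
    barrier k (b - 2) x y ^+ 3 * (k + 2^-1 * sqdist x y) ^+ 2.
  rewrite /barrier -powR_mulrn ?powR_ge0// -powRrM.
  rewrite -[X in _ = _ * X]powR_mulrn; last exact: ltW.
  rewrite -powRD; last by rewrite (gt_eqF q0) implybT.
  by congr (_ `^ _); ring.
have grad i : pderiv i (barrier k b x) y = b * barrier k (b - 1) x y *
    (y 0 i - x 0 i).
  by rewrite pderiv_barrier// -mulrA.
under eq_bigr => i _.
  under eq_bigr => j _ do rewrite pderiv2_barrier// !grad.
  over.
set P := barrier k (b - 1) x y in B1 *.
set Q := barrier k (b - 2) x y in B1 B3 *.
pose d i := y 0 i - x 0 i.
have inner (i : 'I_n.+1) : \sum_(j < n.+1)
    (b * (b - 1) * Q * d i * d j + (i == j)%:R * b * P) *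
      (b * P * d i) * (b * P * d j) =
    b ^+ 3 * P ^+ 2 * d i ^+ 2 * ((b - 1) * Q * sqdist x y + P).
  (* The rank-one part of the Hessian sums to [sqdist x y]; in the identity part only [j = i]
     survives. *)
  transitivity (b ^+ 3 * P ^+ 2 * d i ^+ 2 * (b - 1) * Q * sqdist x y +
      \sum_(j < n.+1) (i == j)%:R * (b ^+ 3 * P ^+ 3 * d i * d j)).
    rewrite /sqdist mulr_sumr -big_split; apply: eq_bigr => j _ /=.
    by rewrite -/(d j); ring.
  rewrite (bigD1 i)//= big1 => [|j /negPf ji]; last by rewrite eq_sym ji mul0r.
  by rewrite eqxx mul1r addr0; ring.
rewrite (eq_bigr _ (fun i _ => inner i)) -mulr_suml -mulr_sumr -/(sqdist x y).
by rewrite B3 B1; ring.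
Qed.

End barrier.

(** For b = 2 / (3 + gamma) one has 3 b - 2 = - b gamma, so both sides share the factor q^(3 b - 4),
    where S is the squared distance and q = k + S / 2. What remains is b^3 S (q + (b - 1) S) < q^2.
    It follows from S <= 2 q and b <= 2/3, since 2 b^3 <= 16/27 < 1. *)
Lemma inf_laplacian_barrier_lt {R : realType} {n : nat} (gamma k : R)
    (x y : 'rV[R]_n.+1) : 0 <= gamma < 1 -> 0 < k ->
  inf_laplacian (barrier k (alpha gamma / 2) x) y <
  barrier k (alpha gamma / 2) x y `^ (- gamma).
Proof.
move=> /andP[g0 g1] k0; have q0 := barrier_arg_gt0 x y k0.
set b := alpha gamma / 2.
have g3 : 3 + gamma != 0 by rewrite gt_eqF// ltr_wpDr.
have bE : b * (3 + gamma) = 2 by rewrite /b /alpha; field.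
have b0 : 0 < b by nra.
have b23 : b <= 2 / 3 by nra.
have -> : barrier k b x y `^ (- gamma) =
    barrier k (3 * b - 4) x y * (k + 2^-1 * sqdist x y) ^+ 2.
  rewrite /barrier -powRrM -[X in _ = _ * X]powR_mulrn; last exact: ltW.
  rewrite -powRD; last by rewrite (gt_eqF q0) implybT.
  by congr (_ `^ _); rewrite mulrN; lra.
rewrite inf_laplacian_barrier// -/b.
have X0 : 0 < barrier k (3 * b - 4) x y by rewrite powR_gt0.
set X := barrier k (3 * b - 4) x y in X0 *.
have -> : b ^+ 3 * X * sqdist x y *
    (k + 2^-1 * sqdist x y + (b - 1) * sqdist x y) = X *
    (b ^+ 3 * ((k + 2^-1 * sqdist x y + (b - 1) * sqdist x y) * sqdist x y)).
  by ring.
rewrite ltr_pM2l//.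
have S0 := sqdist_ge0 x y.
move: q0 S0; set S := sqdist x y; set q := k + _ => q0 S0.
have Sq : S <= 2 * q by rewrite /q; lra.
have b3 : b ^+ 3 <= 8 / 27.
  have : b ^+ 2 <= (2 / 3) ^+ 2 by rewrite lerXn2r// nnegrE// ltW.
  by rewrite !expr2 !exprS expr0 mulr1; nra.
have b30 : 0 <= b ^+ 3 by rewrite exprn_ge0// ltW.
have h1 : (q + (b - 1) * S) * S <= q * (2 * q) by nra.
have h2 : b ^+ 3 * ((q + (b - 1) * S) * S) <= b ^+ 3 * (q * (2 * q)).
  exact: ler_wpM2l.
apply: le_lt_trans h2 _.
have qq : 0 < q * q by rewrite mulr_gt0.
rewrite expr2; nra.
Qed.

(** * The constants, and the right-hand side above the cutoff level *)

Section params.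
Context {R : realType} (gamma : R) (hgamma : 0 <= gamma < 1).

Lemma alpha_gt1 : 1 < alpha gamma.
Proof.
have /andP[g0 g1] := hgamma.
rewrite /alpha ltr_pdivlMr; lra.
Qed.

Lemma alpha_lt2 : alpha gamma < 2.
Proof.
have /andP[g0 g1] := hgamma.
rewrite /alpha ltr_pdivrMr; lra.
Qed.

Lemma delta_gt0 : 0 < delta gamma.
Proof. by rewrite /delta mulr_gt0// powR_gt0// (lt_trans _ alpha_gt1). Qed.

(** The number 1/2 separates the two: [alpha gamma > 1] makes the second factor of [delta] less than
    1, and [alpha gamma / 2 <= 1] keeps the power of 1/2 at least 1/2. The gap yields the final
    contradiction at the centre of the ball. *)
Lemma delta_lt : delta gamma < 2^-1 `^ (alpha gamma / 2).
Proof.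
have a1 := alpha_gt1; have a2 := alpha_lt2.
have a0 : 0 < alpha gamma by rewrite (lt_trans _ a1).
apply: (@lt_le_trans _ _ 2^-1).
  rewrite /delta -/(alpha gamma) gtr_pMr ?invr_gt0// powRN invf_lt1 ?powR_gt0//.
  by have := @gt0_ltr_powR _ _ a0 1 (alpha gamma); rewrite powR1; apply;
    rewrite ?nnegrE ?ler01 ?ltW.
have := @ger1_powR _ 2^-1 (alpha gamma / 2); apply; last lra.
by rewrite invr_gt0 ltr0n/=; lra.
Qed.

Lemma rhs_ge_delta (B : R -> R) (eps s : R) : admissible_cutoff gamma B ->
  0 < eps -> delta gamma * eps `^ alpha gamma <= s ->
  rhs gamma B eps s = s `^ (- gamma).
Proof.
move=> [_ _ _ B1] e0 ds; have d0 := delta_gt0.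
have ea0 : 0 < eps `^ alpha gamma by rewrite powR_gt0.
have dea : 0 < delta gamma * eps `^ alpha gamma by rewrite mulr_gt0.
rewrite /rhs ifF; first by rewrite B1 ?mul1r// ler_pdivlMr.
apply/negbTE; rewrite -ltNge (lt_le_trans _ ds)//; nra.
Qed.

(** [lower_rhs] is the power [- gamma] of the level delta eps^alpha / 2, which lies below [s], and
    this power is nonincreasing. The barrier can thus be compared with [ulow]. *)
Lemma powRN_le_lower_rhs (eps s : R) : 0 < eps ->
  delta gamma * eps `^ alpha gamma <= s ->
  s `^ (- gamma) <= lower_rhs gamma eps.
Proof.
move=> e0 ds; have d0 := delta_gt0; have /andP[g0 g1] := hgamma.
have ea0 : 0 < eps `^ alpha gamma by rewrite powR_gt0.
have dea : 0 < delta gamma * eps `^ alpha gamma by rewrite mulr_gt0.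
have d20 : 0 < delta gamma / 2 by rewrite divr_gt0.
rewrite /lower_rhs -mulrN powRrM -powRM ?powR_ge0//; last exact: ltW.
rewrite !powRN lef_pV2 ?posrE ?powR_gt0//; last 2 first.
- exact: lt_le_trans ds.
- exact: mulr_gt0.
apply: ge0_ler_powR => //; rewrite ?nnegrE.
- by rewrite ltW// mulr_gt0.
- exact/ltW/(lt_le_trans dea).
- by apply: le_trans ds; nra.
Qed.

End params.

(** * Viscosity supersolutions: minimum, gluing and comparison *)

Lemma within_continuous_min {R : realType} {T : topologicalType} (A : set T)
    (f g : T -> R) :
  {within A, continuous f} -> {within A, continuous g} ->
  {within A, continuous (f \min g)}.
Proof.
by move=> fc gc x; apply: (@continuous_min R (subspace A) f g x); [exact: fc|exact: gc].
Qed.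

Section viscosity.
Context {R : realType} {n : nat}.
Local Notation V := 'rV[R]_n.+1.
Implicit Types (Omega U K : set V) (w g phi psi : V -> R) (f : R -> R).

(** A test function touching the minimum from below also touches whichever of the two functions
    attains it at that point. *)
Lemma visc_supersolution_min Omega f w1 w2 :
  visc_supersolution Omega f w1 -> visc_supersolution Omega f w2 ->
  visc_supersolution Omega f (w1 \min w2).
Proof.
move=> s1 s2 psi z Oz psiC touch.
have [ww|ww] := leP (w1 z) (w2 z).
- have -> : (w1 \min w2) z = w1 z by rewrite /= min_l.
  apply: s1 => //; apply: filterS touch => y /=; rewrite (min_l ww) => h.
  by apply: (le_trans h); rewrite lerD2r ge_min lexx.
- have -> : (w1 \min w2) z = w2 z by rewrite /= min_r// ltW.
  apply: s2 => //; apply: filterS touch => y /=; rewrite (min_r (ltW ww)) => h.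
  by apply: (le_trans h); rewrite lerD2r ge_min lexx orbT.
Qed.

Definition glue_min U w g : V -> R :=
  fun y => if y \in U then Num.min (w y) (g y) else w y.

Lemma glue_min_le U w g y : glue_min U w g y <= w y.
Proof. by rewrite /glue_min; case: ifP => // _; rewrite ge_min lexx. Qed.

(** Where the glued function equals [w], a test function touching it from below touches [w] too.
    Elsewhere the point lies in the open set [U] and the test function touches [g], to which
    [inf_laplacian_touch] applies. *)
Lemma visc_supersolution_glue Omega U f w g :
  open Omega -> open U -> visc_supersolution Omega f w ->
  Ck 2 Omega g -> (forall y, U y -> inf_laplacian g y <= f (g y)) ->
  visc_supersolution Omega f (glue_min U w g).
Proof.
move=> oO oU sw gC gf psi z Oz psiC touch.
have [|/eqP wz] := eqVneq (glue_min U w g z) (w z).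
  move=> wz; rewrite wz; apply: sw => //; apply: filterS touch => y.
  by rewrite wz => /le_trans; apply; rewrite lerD2r glue_min_le.
have Uz : U z.
  by move: wz; rewrite /glue_min; case: ifPn => [/set_mem//|_ /eqP/[!eqxx]].
have gz : glue_min U w g z = g z.
  move: wz; rewrite /glue_min mem_set// => /eqP.
  by case: leP => //; rewrite eqxx.
rewrite gz; apply: le_trans (gf _ Uz).
apply: (inf_laplacian_touch oO Oz psiC gC).
have nU : \forall y \near z, U y by exact: open_nbhs_nbhs.
apply: filterS2 nU touch => y Uy; rewrite gz => /le_trans; apply.
by rewrite lerD2r /glue_min mem_set// ge_min lexx orbT.
Qed.

(** At points of the closure outside [U], the strict inequality [w < g] persists nearby, so the
    glued function is locally [w] there, as it is off the closure. *)
Lemma continuous_glue_min (A : set V) U w g :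
  open U -> {within A, continuous w} -> continuous g ->
  (forall y, closure U y -> ~ U y -> w y < g y) ->
  {within A, continuous (glue_min U w g)}.
Proof.
move=> oU wc gc wg; apply/subspace_continuousP => z Az.
have wz : w y @[y --> within A (nbhs z)] --> w z.
  by move/subspace_continuousP : wc; exact.
have gz : g y @[y --> within A (nbhs z)] --> g z.
  by apply: cvg_within_filter; exact: gc.
have [Uz|nUz] := pselect (U z).
  rewrite /from_subspace.
  have -> : glue_min U w g z = (w \min g) z by rewrite /glue_min mem_set.
  have /subspace_continuousP/(_ z Az) : {within A, continuous (w \min g)}.
    by apply: within_continuous_min => //; exact: continuous_subspaceT.
  apply: cvg_trans; apply: near_eq_cvg; apply: cvg_within.
  have : \forall y \near z, U y by exact: open_nbhs_nbhs.
  by apply: filterS => y Uy; rewrite /glue_min mem_set.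
rewrite /from_subspace.
have -> : glue_min U w g z = w z by rewrite /glue_min memNset.
apply: (cvg_trans _ wz); apply: near_eq_cvg.
have [cUz|ncUz] := pselect (closure U z).
  have : \forall y \near within A (nbhs z), 0 < g y - w y.
    by apply: (cvgr_gt (g z - w z) (cvgB gz wz)); rewrite subr_gt0; exact: wg.
  apply: filterS => y; rewrite subr_gt0 /glue_min => wgy.
  by case: ifP => // _; rewrite min_l// ltW.
have oC : open (~` closure U) by rewrite openC; exact: closed_closure.
apply: cvg_within.
have : \forall y \near z, (~` closure U) y by exact: open_nbhs_nbhs.
apply: filterS => y /= ncUy; rewrite /glue_min memNset// => Uy.
exact/ncUy/subset_closure.
Qed.

(** If [w - g] attained its maximum over the compact closure inside [U], then [g] would be a test
    function from above there, against its strict inequality. So the maximum is attained where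
    [w <= g] is given. *)
Lemma visc_subsolution_comparison Omega U (C : R) w g :
  open Omega -> open U -> closure U `<=` Omega -> compact (closure U) ->
  {within closure Omega, continuous w} ->
  visc_subsolution Omega (fun=> C) w ->
  Ck 2 Omega g -> continuous g -> (forall y, U y -> inf_laplacian g y < C) ->
  (forall y, closure U y -> ~ U y -> w y <= g y) ->
  forall y, U y -> w y <= g y.
Proof.
move=> oO oU cUO Kc wc ws gC gc gC_ bd y Uy.
have cU0 : closure U !=set0 by exists y; exact: subset_closure.
have hc : {within closure U, continuous (w - g)}.
  move=> z; apply: (@continuousB _ _ (subspace (closure U)) w g); last first.
    exact: continuous_subspaceT.
  apply: continuous_subspaceW wc _ => //.
  by apply: subset_trans cUO _; exact: subset_closure.
have [c /set_mem cU cmax] := compact_EVT_max cU0 Kc hc.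
have ymax := cmax y (mem_set (subset_closure Uy)).
rewrite -subr_le0; apply: (le_trans ymax).
have [Uc|nUc] := pselect (U c); last by rewrite subr_le0; exact: bd.
exfalso; suff : C <= inf_laplacian g c by rewrite leNgt gC_.
apply: (ws g c) => //; first exact: cUO.
have : \forall z \near c, U z by exact: open_nbhs_nbhs.
apply: filterS => z Uz; exact: (cmax z (mem_set (subset_closure Uz))).
Qed.

End viscosity.

Lemma within_continuous_interior {R : realType} {T : topologicalType}
    (A O : set T) (f : T -> R) (x : T) :
  open O -> O `<=` A -> {within A, continuous f} -> O x ->
  f y @[y --> x] --> f x.
Proof.
move=> oO OA fc Ox.
have := continuous_subspaceW OA fc.
by rewrite continuous_open_subspace// => /(_ x (mem_set Ox)).
Qed.

(** * Euclidean balls and their inclusion in the domain *)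

Section euclidean_ball.
Context {R : realType} {n : nat}.
Local Notation V := 'rV[R]_n.+1.
Implicit Types (x y z : V) (r s : R).

Lemma enorm_sqdist x y : enorm (y - x) = Num.sqrt (sqdist x y).
Proof. by congr Num.sqrt; apply: eq_bigr => i _; rewrite !mxE. Qed.

Lemma eballE x r : 0 < r -> eball x r = [set y | sqdist x y < r ^+ 2].
Proof.
move=> r0; apply/funext => y; apply/propext; rewrite /eball /= enorm_sqdist.
by rewrite -[X in _ <-> X < _]sqr_sqrtr ?sqdist_ge0// ltr_pXn2r// nnegrE// ltW.
Qed.

Lemma open_eball x r : 0 < r -> open (eball x r).
Proof.
move=> r0; rewrite eballE//.
apply: (@open_comp _ _ (sqdist x) [set t | t < r ^+ 2]); last exact: open_lt.
by move=> y _; exact: continuous_sqdist.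
Qed.

Lemma closure_eball x r : 0 < r ->
  closure (eball x r) `<=` [set y | sqdist x y <= r ^+ 2].
Proof.
move=> r0; have cD : closed [set y | sqdist x y <= r ^+ 2].
  apply: (@preimage_closed _ _ (sqdist x) [set t | t <= r ^+ 2]).
    by move=> y _; exact: continuous_sqdist.
  exact: closed_le.
rewrite [X in _ `<=` X]((closure_id _).1 cD); apply: closureS; rewrite eballE// => y /=.
exact: ltW.
Qed.

Lemma closure_eball_sub x r s : 0 < r < s -> closure (eball x r) `<=` eball x s.
Proof.
move=> /andP[r0 rs] y /(closure_eball r0)/= yr.
have s0 := lt_trans r0 rs.
by rewrite eballE//= (le_lt_trans yr)// ltr_pXn2r// nnegrE ltW.
Qed.

Lemma eball_center x r : 0 < r -> eball x r x.
Proof.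
move=> r0; rewrite eballE//= /sqdist big1 ?exprn_gt0// => i _.
by rewrite subrr expr0n.
Qed.

(** The segment from [x] to a point of the ball stays closer than [r] to [x], so it misses the
    boundary. Its part in [Omega] is then relatively open and closed, and connectedness makes it the
    whole segment. *)
Lemma eball_sub_open (Omega : set V) x r : open Omega -> Omega x -> 0 < r ->
  (forall z, bdry Omega z -> r <= enorm (x - z)) -> eball x r `<=` Omega.
Proof.
move=> oO Ox r0 rb y; rewrite eballE//= => yr.
pose c t : V := x + t *: (y - x).
pose A := c @` `[0, 1].
have cA : connected A.
  apply: connected_continuous_connected; first exact: segment_connected.
  apply: continuous_subspaceT => t; apply: (@cvgD _ _ _ (nbhs t)).
    exact: cvg_cst.
  by apply: cvgZr_tmp; exact: cvg_id.
have AO : A `&` Omega = A `&` closure Omega.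
  apply/seteqP; split=> z [Az Oz]; split=> //; first exact: subset_closure.
  apply: contrapT => nOz.
  have : r <= enorm (x - z) by apply: rb; split=> // /interior_subset.
  apply/negP; rewrite -ltNge enorm_sqdist.
  have [t + <-] := Az; rewrite /= in_itv/= => /andP[t0 t1].
  have -> : sqdist (c t) x = t ^+ 2 * sqdist x y.
    rewrite /sqdist mulr_sumr; apply: eq_bigr => i _.
    by rewrite /c !mxE; ring.
  rewrite -(ger0_norm (ltW r0)) -sqrtr_sqr ltr_sqrt ?exprn_gt0//.
  by apply: le_lt_trans yr; rewrite ler_piMl ?sqdist_ge0// exprn_ile1.
have c0 : c 0 = x by rewrite /c scale0r addr0.
have AOE : A `&` Omega = A.
  apply: cA.
  - exists x; split=> //; exists 0 => //.
    by rewrite /= in_itv/= lexx ler01.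
  - by exists Omega.
  - by exists (closure Omega) => //; exact: closed_closure.
have : A y.
  exists 1; first by rewrite /= in_itv/= lexx ler01.
  by rewrite /c scale1r addrC subrK.
by rewrite -AOE => -[].
Qed.

Lemma compact_closure_sub (A Omega : set V) :
  bounded_set Omega -> closure A `<=` Omega -> compact (closure A).
Proof.
move=> bO AO; apply: bounded_closed_compact; last exact: closed_closure.
by apply: sub_boundedr bO => P OP z /AO; exact: OP.
Qed.

End euclidean_ball.

(** * The Perron class and its infimum *)

Section perron.
Context {R : realType} {n : nat}.
Local Notation V := 'rV[R]_n.+1.
Context (gamma : R) (B : R -> R) (eps : R) (Omega : set V)
  (ulow uup : V -> R).
Local Notation perron := (perron_class gamma B eps Omega ulow uup).
Local Notation u := (minimal_solution gamma B eps Omega ulow uup).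

Lemma perron_class_min (w1 w2 : V -> R) :
  perron w1 -> perron w2 -> perron (w1 \min w2).
Proof.
move=> [c1 s1 b1] [c2 s2 b2]; split.
- exact: within_continuous_min.
- exact: visc_supersolution_min.
- move=> y Oy; have /andP[l1 u1] := b1 y Oy; have /andP[l2 u2] := b2 y Oy.
  by rewrite /= le_min l1 l2/= ge_min u1.
Qed.

Lemma minimal_solution_le (w : V -> R) (y : V) :
  perron w -> closure Omega y -> u y <= w y.
Proof.
move=> pw Oy; apply: ge_inf; last by exists w.
(* The lower barrier bounds the set from below, so [inf] is a genuine infimum. *)
by exists (ulow y) => _ [v [_ _ bv] <-]; case/andP: (bv y Oy).
Qed.

Lemma perron_class_lt_compact (K : set V) (g : V -> R) :
  open Omega -> compact K -> K `<=` Omega -> continuous g ->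
  perron !=set0 -> (forall y, K y -> u y < g y) ->
  exists2 w, perron w & forall y, K y -> w y < g y.
Proof.
move=> oO cK KO gc [w0 pw0] ug.
(* The Perron class is directed downwards, so its lower sections generate a
   filter, to which the near-covering form of compactness applies. *)
pose below w1 := [set w | perron w /\ forall y, w y <= w1 y].
pose F := filter_from perron below.
have FF : Filter F.
  apply: filter_from_filter; first by exists w0.
  move=> w1 w2 p1 p2; exists (w1 \min w2); first exact: perron_class_min.
  move=> w [pw le]; split; split=> // y; apply: (le_trans (le y)).
    by rewrite ge_min lexx.
  by rewrite ge_min lexx orbT.
have [w1 pw1 w1K] : F [set w | K `<=` [set y | w y < g y]].
  apply: ((compact_near_coveringP K).1 cK _ F (fun w y => w y < g y) FF) => y Ky.
  (* Some member lies below [g] at [y]; continuity spreads this to a neighbourhood, and every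
     smaller member inherits it. *)
  have [_ [w1 pw1 <-] w1y] : exists2 t, [set w y | w in perron] t & t < g y.
    by apply: inf_lt; [exists (w0 y); exists w0|exact: ug].
  have w1c : w1 z @[z --> y] --> w1 y.
    case: pw1 => wc _ _; apply: (within_continuous_interior oO _ wc (KO _ Ky)).
    exact: subset_closure.
  exists ([set z | 0 < g z - w1 z], below w1) => /=.
    split; last by exists w1.
    have gw : g z - w1 z @[z --> y] --> g y - w1 y.
      by apply: (@cvgB _ _ _ (nbhs y)) => //; exact: gc.
    by apply: (cvgr_gt (g y - w1 y) gw); rewrite subr_gt0.
  move=> [z w] /= [+ [_ ww1]]; rewrite subr_gt0; exact: le_lt_trans.
by exists w1 => // y Ky; apply: w1K.
Qed.

End perron.

(** Gluing only lowers [w], so the upper bound is kept. The lower bound needs [ulow <= g] in [U],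
    which is comparison with the boundary inequality [ulow <= w < g]. *)
Lemma perron_class_glue {R : realType} {n : nat} (gamma : R) (B : R -> R)
    (eps : R) (Omega U : set 'rV[R]_n.+1) (ulow uup w g : 'rV[R]_n.+1 -> R) :
  open Omega -> open U -> closure U `<=` Omega -> compact (closure U) ->
  {within closure Omega, continuous ulow} ->
  visc_subsolution Omega (fun=> lower_rhs gamma eps) ulow ->
  perron_class gamma B eps Omega ulow uup w ->
  Ck 2 Omega g -> continuous g ->
  (forall y, U y -> inf_laplacian g y < lower_rhs gamma eps) ->
  (forall y, U y -> inf_laplacian g y <= rhs gamma B eps (g y)) ->
  (forall y, closure U y -> ~ U y -> w y < g y) ->
  perron_class gamma B eps Omega ulow uup (glue_min U w g).
Proof.
move=> oO oU cUO cpU lc lsub [wc ws wb] gC gc gl gr wg.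
split; first exact: continuous_glue_min.
  exact: visc_supersolution_glue.
move=> y Oy; have /andP[lw wu] := wb y Oy.
rewrite (le_trans (glue_min_le _ _ _ _) wu) andbT /glue_min.
case: ifP => // /set_mem Uy; rewrite le_min lw/=.
apply: (visc_subsolution_comparison oO oU cUO cpU lc lsub gC gc gl) => // z cUz nUz.
have /andP[lz _] := wb z (subset_closure (cUO z cUz)).
exact: le_trans lz (ltW (wg z cUz nUz)).
Qed.

(** * The growth estimate *)

Theorem theorem7 (R : realType) (gamma : R) (hgamma : 0 <= gamma < 1) :
  exists2 c : R, 0 < c &
    forall (n : nat) (Omega : set 'rV[R]_n.+1) (phi : 'rV[R]_n.+1 -> R)
      (B : R -> R) (eps : R) (ulow uup : 'rV[R]_n.+1 -> R),
      bounded_smooth_domain Omega ->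
      smooth_boundary_datum Omega phi ->
      (forall y, bdry Omega y -> 0 <= phi y) ->
      admissible_cutoff gamma B ->
      0 < eps ->
      visc_dirichlet_solution Omega (fun=> lower_rhs gamma eps) phi ulow ->
      visc_dirichlet_solution Omega (fun=> 0) phi uup ->
      let u := minimal_solution gamma B eps Omega ulow uup in
      forall x : 'rV[R]_n.+1, Omega x ->
        c * eps `^ alpha gamma <= u x ->
        forall r : R, eps <= r <= edist_to (bdry Omega) x / 2 ->
          c * r `^ alpha gamma <= sup [set u y | y in eball x r].
Proof.
have a1 := alpha_gt1 hgamma; have dc := delta_lt hgamma.
have d0 := delta_gt0 hgamma.
(* This [c] satisfies (s^2 / 2)^(a / 2) = c s^a, the value of the barrier on the sphere of radius s
   in the limit k = 0. *)
set a := alpha gamma in a1 dc *; set c := 2^-1 `^ (a / 2) in dc *.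
have a0 : 0 < a by exact: lt_trans a1.
have a20 : 0 < a / 2 by rewrite divr_gt0.
have c0 : 0 < c by rewrite powR_gt0// invr_gt0.
exists c => // n Omega phi B eps ulow uup [oO _ _ bO _] _ _ cB e0.
move=> [lc lsub _ _] [uc _ _ _] u x Ox cu r /andP[er rd].
have r0 : 0 < r by exact: lt_le_trans er.
have ea0 : 0 < eps `^ a by rewrite powR_gt0.
have dea0 : 0 < delta gamma * eps `^ a by rewrite mulr_gt0.
rewrite leNgt; apply/negP; set M := sup _ => Mr.
(* Over an empty class the infimum would be 0 by convention, against the positive lower bound on
   [u x]. *)
have [w0 pw0] : perron_class gamma B eps Omega ulow uup !=set0.
  apply/set0P/negP => /eqP P0; move: cu.
  rewrite /u /minimal_solution P0 image_set0 inf0 leNgt => /negP; apply.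
  exact: mulr_gt0.
have ball2 : eball x (2 * r) `<=` Omega.
  apply: eball_sub_open => //; first exact: mulr_gt0.
  move=> z bz; rewrite mulrC -ler_pdivlMr//; apply: (le_trans rd).
  rewrite ler_pM2r ?invr_gt0//; apply: ge_inf; last by exists z.
  by exists 0 => _ [y _ <-]; exact: sqrtr_ge0.
have closub s : 0 < s <= r -> closure (eball x s) `<=` Omega.
  move=> /andP[s0 sr]; apply: subset_trans ball2.
  by apply: closure_eball_sub; rewrite s0 (le_lt_trans sr)// ltr_pMl// ltr1n.
have rr : 0 < r <= r by rewrite r0 lexx.
(* The supremum dominates its set only if that set is bounded above; the maximum of [uup] on the
   compact closed ball is a bound. *)
have uM y : eball x r y -> u y <= M.
  move=> ry; apply: ub_le_sup; last by exists y.
  have cpt := compact_closure_sub bO (closub _ rr).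
  have [||z _ zmax] := compact_EVT_max (f := uup) _ cpt.
  - by exists x; apply: subset_closure; exact: eball_center.
  - apply: continuous_subspaceW uc.
    exact: subset_trans (closub _ rr) (@subset_closure _ _).
  exists (uup z) => _ [y' ry' <-].
  have cy' := subset_closure ry'.
  have Oy' := subset_closure (closub _ rr _ cy').
  apply: (le_trans (minimal_solution_le pw0 Oy')).
  have [_ _ /(_ y' Oy') /andP[_ wu]] := pw0.
  exact: le_trans wu (zmax _ (mem_set cy')).
have M0 : 0 < M.
  apply: lt_le_trans (uM x (eball_center _ r0)).
  by apply: lt_le_trans cu; exact: mulr_gt0.
(* The radius at which c s^a = M; the assumption M < c r^a places it below [r]. *)
pose s := (M / c) `^ a^-1.
have Mc0 : 0 < M / c by rewrite divr_gt0.
have s0 : 0 < s by rewrite powR_gt0.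
have sa : s `^ a = M / c by rewrite /s -powRrM mulVf ?gt_eqF// powRr1// ltW.
have sr : s < r.
  rewrite ltNge; apply/negP => rs.
  have : r `^ a <= s `^ a.
    by apply: ge0_ler_powR rs; rewrite ?nnegrE ltW.
  by rewrite sa ler_pdivlMr// mulrC leNgt Mr.
have ssr : 0 < s <= r by rewrite s0 ltW.
pose k := (delta gamma * eps `^ a) `^ (2 / a).
have k0 : 0 < k by rewrite powR_gt0.
have kE : k `^ (a / 2) = delta gamma * eps `^ a.
  rewrite /k -powRrM (_ : 2 / a * (a / 2) = 1) ?powRr1 ?ltW//.
  by field; rewrite gt_eqF.
pose g := barrier k (a / 2) x.
have gd y : delta gamma * eps `^ a <= g y.
  rewrite -kE /g /barrier; apply: ge0_ler_powR; rewrite ?nnegrE.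
  - exact: ltW.
  - exact: ltW.
  - by rewrite ltW// barrier_arg_gt0.
  - by rewrite lerDl mulr_ge0// sqdist_ge0.
(* Outside the ball the base of [g] is at least k + s^2 / 2, and [k > 0] makes the inequality
   strict. *)
have gM y : ~ eball x s y -> M < g y.
  rewrite eballE//= => /negP; rewrite -leNgt => sy.
  have -> : M = (2^-1 * s ^+ 2) `^ (a / 2).
    rewrite powRM ?exprn_ge0 ?invr_ge0 ?ltW// -/c.
    rewrite -powR_mulrn ?ltW// -powRrM mulrCA divff ?mulr1//.
    by rewrite sa mulrCA divff ?mulr1// gt_eqF.
  apply: gt0_ltr_powR => //; rewrite ?nnegrE.
  - by rewrite mulr_ge0// exprn_ge0// ltW.
  - by rewrite ltW// barrier_arg_gt0.
  - have : 2^-1 * s ^+ 2 <= 2^-1 * sqdist x y by rewrite ler_pM2l.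
    by move/le_lt_trans; apply; rewrite ltrDr.
have gc : continuous g by exact: continuous_barrier.
have gl (y : 'rV[R]_n.+1) : inf_laplacian g y < g y `^ (- gamma).
  exact: inf_laplacian_barrier_lt.
pose K := closure (eball x s) `\` eball x s.
have KO : K `<=` Omega by move=> y [/(closub _ ssr)].
have oB : open (eball x s) by exact: open_eball.
have cptB := compact_closure_sub bO (closub _ ssr).
have cK : compact K.
  apply: (subclosed_compact _ cptB); last by move=> ? [].
  by apply: closedI; [exact: closed_closure|rewrite closedC].
have [w pw wg] : exists2 w, perron_class gamma B eps Omega ulow uup w &
    forall y, K y -> w y < g y.
  apply: perron_class_lt_compact => //; first by exists w0.
  move=> y [cy ny]; apply: le_lt_trans (gM _ ny).
  by apply: uM; apply: closure_eball_sub cy; rewrite s0.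
have pv : perron_class gamma B eps Omega ulow uup (glue_min (eball x s) w g).
  apply: perron_class_glue => //; first exact: closub.
  - exact: Ck2_barrier.
  - move=> y _; apply: lt_le_trans (gl y) _.
    exact: powRN_le_lower_rhs.
  - by move=> y _; rewrite (rhs_ge_delta hgamma)// ltW.
  - by move=> y cy ny; apply: wg.
(* At the centre the glued function is at most [g x], hence [u x <= g x], and [g x] equals delta
   eps^a < c eps^a. *)
have := minimal_solution_le pv (subset_closure Ox).
rewrite /glue_min mem_set; last exact: eball_center.
rewrite le_min => /andP[_]; apply/negP; rewrite -ltNge.
apply: lt_le_trans cu.
have -> : g x = delta gamma * eps `^ a.
  rewrite -kE /g /barrier /sqdist big1 ?mulr0 ?addr0// => i _.
  by rewrite subrr expr0n.
by rewrite ltr_pM2r.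
Qed.
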